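(* For all integers $r\ge 2$, $k\ge 1$, $t\ge 1$, $$\chi(S_k^r,t)\le t(k-1)+2.$$
   Context: Hypergraphs $H=(V,E)$ are finite: $V$ is a nonempty finite set of vertices and $E$ is a set of subsets of $V$ (edges), each of size at least $2$; $H$ is $r$-uniform if all edges have size $r$. The edge set of a hypergraph being colored is allowed to be empty. A $k$-coloring $c:V\to\{1,\dots,k\}$ is proper if no edge is monochromatic; the chromatic number $\chi(H)$ is the least $m\ge 1$ such that $H$ has a proper $m$-coloring, and then $H$ is called $m$-chromatic. $S_k^r$ denotes the $r$-uniform star with $k$ edges: $k$ edges of size $r$ all containing one common vertex and otherwise pairwise disjoint, with no further vertices. A $t$-edge-coloring of $H=(V,E)$ is a partition $E=E_1\cup\dots\cup E_t$ into $t$ pairwise disjoint (possibly empty) color classes. A monochromatic copy of $T$ is a (not necessarily induced) subhypergraph isomorphic to $T$ all of whose edges lie in one class $E_i$. For an acyclic $r$-uniform hypergraph $T$ (such as $S_k^r$), the ($t$-color) chromatic Ramsey number $\chi(T,t)$ is the smallest positive integer $m$ such that under any $t$-edge-coloring of any $m$-chromatic $r$-uniform hypergraph there is a monochromatic copy of $T$. An upper bound on $\chi(T,t)$ includes the assertion that such an $m$ exists. *)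

(* Defs.v *)
From mathcomp Require Import all_boot.

Set Implicit Arguments.
Unset Strict Implicit.
Unset Printing Implicit Defensive.

Record hypergraph := Hypergraph {
  vertex :> finType;
  edges : {set {set vertex}};
  vertex_gt0 : 0 < #|vertex|;
  edges_gt1 : forall e, e \in edges -> 1 < #|e|
}.

Definition uniform (r : nat) (H : hypergraph) : Prop :=
  forall e, e \in edges H -> #|e| = r.

Section Coloring.

Variable H : hypergraph.

Definition monochromatic (m : nat) (c : {ffun H -> 'I_m}) (e : {set H}) : bool :=
  [exists i, [forall x in e, c x == i]].

Definition proper_coloring (m : nat) (c : {ffun H -> 'I_m}) : bool :=
  [forall e in edges H, ~~ monochromatic c e].

Definition colorable (m : nat) : bool :=
  [exists c : {ffun H -> 'I_m}, proper_coloring c].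

Lemma colorable_ex : exists m, (0 < m) && colorable m.
Proof.
exists #|H|; rewrite vertex_gt0 /=.
apply/existsP; exists [ffun x => enum_rank x].
apply/forall_inP => e /edges_gt1 /card_gt1P [x [y [xe ye xy]]].
apply/existsP => -[i /forall_inP ci].
have /eqP := ci _ xe; have /eqP := ci _ ye; rewrite !ffunE => <-.
by move/enum_rank_inj => exy; rewrite exy eqxx in xy.
Qed.

Definition chromatic_number : nat := ex_minn colorable_ex.

End Coloring.

Section Star.

Variables (r k : nat).
Hypothesis r_gt1 : 1 < r.

(* [None] is the common vertex; the [i]-th edge has the [r - 1] further
   vertices [Some (i, j)]. *)
Definition star_vertex : finType := option ('I_k * 'I_r.-1).

Definition star_edge (i : 'I_k) : {set star_vertex} :=
  None |: [set Some (i, j) | j : 'I_r.-1].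

Definition star_edges : {set {set star_vertex}} := [set star_edge i | i : 'I_k].

Lemma card_star_edge i : #|star_edge i| = r.
Proof.
rewrite cardsU1 card_imset; last by move=> j j' [].
rewrite card_ord.
have -> : None \notin [set Some (i, j) | j : 'I_r.-1].
  by apply/imsetP => -[].
by rewrite add1n prednK // ltnW.
Qed.

Lemma star_vertex_gt0 : 0 < #|star_vertex|.
Proof. by apply/card_gt0P; exists None. Qed.

Lemma star_edges_gt1 e : e \in star_edges -> 1 < #|e|.
Proof. by case/imsetP => i _ ->; rewrite card_star_edge. Qed.

Definition star : hypergraph := Hypergraph star_vertex_gt0 star_edges_gt1.

Lemma star_uniform : uniform r star.
Proof. by move=> e /imsetP [i _ ->]; rewrite card_star_edge. Qed.

Lemma card_star_edges : #|edges star| = k.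
Proof.
rewrite card_imset ?card_ord // => i i' /setP eq_ii'.
have r1_gt0 : 0 < r.-1 by rewrite -ltnS prednK // ltnW.
have := eq_ii' (Some (i, Ordinal r1_gt0)).
rewrite !in_setU1 /= imset_f // => /esym /imsetP [j _ [-> _]] //.
Qed.

End Star.

Definition edge_coloring (H : hypergraph) (t : nat)
    (C : 'I_t -> {set {set H}}) : Prop :=
  edges H = \bigcup_(i < t) C i /\
  (forall i j, i != j -> [disjoint C i & C j]).

(* [W] and [F] are the vertex and edge sets of the subhypergraph. *)
Definition subhypergraph (H : hypergraph) (W : {set H}) (F : {set {set H}}) :
    Prop :=
  F \subset edges H /\ (forall e, e \in F -> e \subset W).

Definition isomorphic_to_sub (T H : hypergraph) (W : {set H})
    (F : {set {set H}}) : Prop :=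
  exists f : T -> H,
    [/\ injective f, f @: [set: T] = W
      & [set f @: (e : {set T}) | e in edges T] = F].

Definition has_monochromatic_copy (T H : hypergraph) (t : nat)
    (C : 'I_t -> {set {set H}}) : Prop :=
  exists (i : 'I_t) (W : {set H}) (F : {set {set H}}),
    [/\ subhypergraph W F, isomorphic_to_sub T W F & F \subset C i].

Definition chromatic_ramsey_property (r : nat) (T : hypergraph) (t m : nat) :
    Prop :=
  forall H : hypergraph, uniform r H -> chromatic_number H = m ->
  forall C : 'I_t -> {set {set H}}, edge_coloring C ->
  has_monochromatic_copy T C.

(* A relation rather than a function, since no [m] with the property need exist
   for an arbitrary [T]; [r] is the uniformity of [T]. *)
Definition is_chromatic_ramsey_number (r : nat) (T : hypergraph) (t m : nat) :
    Prop :=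
  [/\ 0 < m, chromatic_ramsey_property r T t m
    & forall n, 0 < n -> chromatic_ramsey_property r T t n -> m <= n].

(* Main.v *)
Require Import Defs.
From mathcomp Require Import all_boot.
From Stdlib Require Import Classical.

(** The bound comes from looking at a vertex that obstructs a colouring.  Put
    [n = t * (k - 1)] and let [H] have chromatic number [n + 2], so that [H] is
    not [(n + 1)]-colourable.  Take a maximal vertex set [W] whose induced
    subhypergraph is [(n + 1)]-colourable, with a proper colouring [c] of it,
    and a vertex [v] outside [W].  By maximality none of the [n + 1] colours can
    be given to [v]: for each colour [j] some edge [e j] through [v] has all its
    other vertices in [W] and coloured [j].  Edges belonging to distinct colours
    share only [v], so [v] is the centre of a star with [n + 1] edges
    ([noncolorable_star]).  Among [t * (k - 1) + 1] edges, [k] lie in the same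
    one of the [t] classes ([pigeonhole_injection]), and these form the required
    monochromatic star ([star_copy]).

    Hence [t * (k - 1) + 2] has the Ramsey property; the Ramsey number is the
    least positive integer that has it, whose existence is the well-ordering of
    the natural numbers for an undecidable predicate ([least_witness]). *)

Set Implicit Arguments.
Unset Strict Implicit.
Unset Printing Implicit Defensive.

(** The obstruction argument: a vertex [v] that cannot be added to a maximal
    properly coloured set sees, for each colour [j], an edge whose vertices other
    than [v] all have colour [j], so edges for distinct colours meet only in [v]. *)
Lemma noncolorable_star (H : hypergraph) (n : nat) :
  0 < n -> ~~ colorable H n ->
  exists (v : H) (e : 'I_n -> {set H}),
    [/\ forall j, e j \in edges H, forall j, v \in e j
      & forall i j, i != j -> e i :&: e j = [set v]].
Proof.
case: n => // n _ ncol.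
(* A colouring of [W] is encoded as a colouring of all vertices, constrained
   only on the edges inside [W]. *)
pose proper_on (W : {set H}) (c : {ffun H -> 'I_n.+1}) :=
  [forall e in edges H, (e \subset W) ==> ~~ monochromatic c e].
pose P W := [exists c, proper_on W c].
have P0 : P set0.
  apply/existsP; exists [ffun => ord0]; apply/forall_inP => e /edges_gt1 e_gt1.
  by apply/implyP; rewrite subset0 => /eqP e0; rewrite e0 cards0 in e_gt1.
have [W /maxsetP [/existsP [c /forall_inP cW] maxW] _] := maxset_exists P0.
have [WT | /subsetPn [v _ vW]] := boolP ([set: H] \subset W).
  case/negP: ncol; apply/existsP; exists c; apply/forall_inP => e eH.
  by apply: (implyP (cW e eH)); apply: subset_trans (subsetT e) WT.
have blocked j : exists e : {set H},
    [/\ e \in edges H, v \in e & forall x, x \in e -> x != v -> c x = j].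
  pose cj : {ffun H -> 'I_n.+1} := [ffun x => if x == v then j else c x].
  have : ~~ proper_on (v |: W) cj.
    apply/negP => cjP; move: vW; rewrite -(maxW (v |: W)) ?setU11 ?subsetUr //.
    by apply/existsP; exists cj.
  rewrite negb_forall_in => /exists_inP [e eH].
  rewrite negb_imply negbK => /andP [eW /existsP [i /forall_inP cji]].
  have ve : v \in e.
    apply/negPn/negP => ve.
    have := implyP (cW e eH); rewrite -(setU1K vW) subsetD1 eW ve => /(_ isT).
    case/negP; apply/existsP; exists i; apply/forall_inP => x xe.
    have := cji x xe; rewrite ffunE; case: (x =P v) => // xv.
    by rewrite -xv xe in ve.
  exists e; split=> // x xe xv.
  have := cji v ve; have := cji x xe.
  by rewrite !ffunE eqxx (negPf xv) => /eqP -> /eqP.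
have [e eP] := fin_all_exists blocked.
exists v, e; split=> [j|j|i j ij]; try by case: (eP j).
apply/setP => x; rewrite !inE; apply/andP/eqP => [[xi xj]|->]; last first.
  by case: (eP i) (eP j) => _ ? _ [].
apply/eqP; apply: contraNT ij => xv.
case: (eP i) (eP j) => _ _ ci [_ _ cj].
by rewrite -(ci x xi xv) -(cj x xj xv).
Qed.

Lemma pigeonhole_injection (t k n : nat) (g : 'I_n -> 'I_t) :
  t * (k - 1) < n ->
  exists (i : 'I_t) (s : 'I_k -> 'I_n), injective s /\ forall a, g (s a) = i.
Proof.
move=> lt_n.
have [i leki | small] := pickP (fun i => k <= #|[set j | g j == i]|).
  exists i, (fun a => enum_val (widen_ord leki a)); split=> [a b|a].
    by move/enum_val_inj => [] /val_inj.
  by have := enum_valP (widen_ord leki a); rewrite inE => /eqP.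
have : n <= t * (k - 1).
  rewrite -[n in n <= _]card_ord -sum1_card (partition_big g predT) //=.
  rewrite -[t in t * _]card_ord -sum_nat_const; apply: leq_sum => i _.
  rewrite sum1_card subn1; have := small i; rewrite cardsE.
  by case: k {lt_n small} => [|k] //= /negbT; rewrite -ltnNge ltnS.
by rewrite leqNgt lt_n.
Qed.

(** The common vertex goes to [v], and the [j]-th further vertex of the [a]-th
    star edge to the [j]-th element of [e a :\ v].  Injectivity is exactly the
    condition that distinct [e a] share nothing but [v]; then the image of a
    star edge is all of [e a] because both have [r] elements. *)
Lemma star_copy (r k t : nat) (hr : 1 < r) (H : hypergraph)
    (C : 'I_t -> {set {set H}}) (i : 'I_t) (v : H) (e : 'I_k -> {set H}) :
  C i \subset edges H ->
  (forall a, e a \in C i) -> (forall a, #|e a| = r) -> (forall a, v \in e a) ->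
  (forall a b, a != b -> e a :&: e b = [set v]) ->
  has_monochromatic_copy (star k hr) C.
Proof.
move=> CH eC card_e ve e_meet.
pose f (x : star k hr) : H :=
  if x is Some (a, j) then nth v (enum (e a :\ v)) j else v.
have size_e a : size (enum (e a :\ v)) = r.-1.
  by rewrite -cardE cardsDS ?sub1set // cards1 card_e subn1.
have fP a (j : 'I_r.-1) : f (Some (a, j)) \in e a :\ v.
  by rewrite -mem_enum mem_nth ?size_e.
have f_inj : injective f.
  have fv a j : f (Some (a, j)) <> v by have /setD1P [/eqP] := fP a j.
  case=> [[a j]|] [[b l]|] //; [|by move/fv|by move/esym/fv].
  have [<- /eqP | ab eq_f] := eqVneq a b.
    by rewrite /f nth_uniq ?size_e ?enum_uniq // => /eqP /val_inj ->.
  case: (fv a j); apply/set1P; rewrite -(e_meet _ _ ab) inE {2}eq_f.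
  by have /setD1P [_ ->] := fP a j; have /setD1P [_ ->] := fP b l.
have f_edge (a : 'I_k) : f @: (star_edge r a : {set star k hr}) = e a.
  apply/eqP; rewrite eqEcard card_imset // card_star_edge // card_e leqnn andbT.
  apply/subsetP => _ /imsetP [x xa ->]; case/setU1P: xa => [-> //|].
  by case/imsetP => j _ ->; have /setD1P [] := fP a j.
pose F := [set f @: (d : {set star k hr}) | d in edges (star k hr)].
have FC : F \subset C i.
  by apply/subsetP => _ /imsetP [_ /imsetP [a _ ->] ->]; rewrite f_edge.
exists i, (f @: [set: star k hr]), F; split=> //; last by exists f.
split; first exact: subset_trans CH.
by move=> _ /imsetP [d _ ->]; apply/imsetS/subsetT.
Qed.

Lemma chromatic_numberN_colorable (H : hypergraph) (n : nat) :
  0 < n < chromatic_number H -> ~~ colorable H n.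
Proof.
rewrite /chromatic_number; case: ex_minnP => m _ min_m /andP [n_gt0 lt_nm].
by apply/negP => col; move: lt_nm; rewrite ltnNge min_m // n_gt0.
Qed.

Lemma star_ramsey_property (r k t : nat) (hr : 1 < r) :
  chromatic_ramsey_property r (star k hr) t (t * (k - 1) + 2).
Proof.
move=> H Hr chiH C [EC _].
have [v [e [eH ve e_meet]]] : exists (v : H) (e : 'I_(t * (k - 1)).+1 -> {set H}),
    [/\ forall j, e j \in edges H, forall j, v \in e j
      & forall i j, i != j -> e i :&: e j = [set v]].
  apply: noncolorable_star => //.
  by apply: chromatic_numberN_colorable; rewrite chiH addn2 /=.
have class_of j : exists i, e j \in C i.
  by have := eH j; rewrite EC => /bigcupP [i _]; exists i.
have [g gP] := fin_all_exists class_of.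
have [i [s [s_inj gs]]] := pigeonhole_injection (k := k) g (ltnSn _).
apply: (@star_copy _ _ _ hr _ C i v (e \o s)) => [|a|a|a|a b ab] /=.
- by rewrite EC; apply: bigcup_sup.
- by rewrite -(gs a).
- exact/Hr/eH.
- exact: ve.
- by apply: e_meet; rewrite inj_eq.
Qed.

Lemma least_witness (P : nat -> Prop) (n : nat) :
  P n -> exists m, [/\ P m, m <= n & forall l, P l -> m <= l].
Proof.
elim/ltn_ind: n => n IHn Pn.
have [[l [lt_ln Pl]] | nolt] := classic (exists l, l < n /\ P l).
  have [m [Pm le_ml min_m]] := IHn l lt_ln Pl.
  by exists m; split=> //; apply: leq_trans le_ml (ltnW lt_ln).
exists n; split=> // l Pl; rewrite leqNgt; apply/negP => lt_ln.
by apply: nolt; exists l.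
Qed.

Theorem theorem8 (r k t : nat) (hr : 2 <= r) (hk : 1 <= k) (ht : 1 <= t) :
  exists m : nat,
    is_chromatic_ramsey_number r (star k hr) t m /\ m <= t * (k - 1) + 2.
Proof.
pose P m := 0 < m /\ chromatic_ramsey_property r (star k hr) t m.
have P_bound : P (t * (k - 1) + 2).
  by split; [rewrite addn2 | apply: star_ramsey_property].
have [m [[m_gt0 ram_m] le_m min_m]] := least_witness P_bound.
by exists m; split=> //; split=> // n n_gt0 ram_n; apply: min_m.
Qed.
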